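(* There is an absolute constant $c>0$ and an absolute constant $C>0$ such that the following holds. Let $(X,d)$ be a (finite) metric space and $K\subseteq X$ a set of $k$ terminals such that the metric $(K,d|_K)$ has doubling dimension $\mathrm{ddim}>0$. Let $\pi=(t_1,\dots,t_k)$ be a Gonzalez order of $K$. Let $Z_1,\dots,Z_k$ be i.i.d. exponential random variables with rate $c\cdot\mathrm{ddim}$ (i.e. $\Pr[Z_j\ge a]=e^{-c\cdot\mathrm{ddim}\cdot a}$ for $a\ge 0$), and set $R_j=2e^{Z_j}$. Let $f:X\to K$ be the retraction returned by the Metric-Relaxed-Voronoi algorithm on input $(X,d,K,\pi,R_1,\dots,R_k)$. Then for all $x,y\in X$, $$\mathbb{E}\big[d(f(x),f(y))\big]\le C\cdot \mathrm{ddim}\cdot d(x,y).$$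
   Context: A retraction is a map $f:X\to K$ with $f(t)=t$ for all $t\in K$. For $x\in X$, $D(x)=\min_{t\in K}d(x,t)$. A metric space has doubling dimension $\mathrm{ddim}$ if every ball of radius $r>0$ can be covered by at most $2^{\mathrm{ddim}}$ balls of radius $r/2$. Gonzalez order of $K$: $t_1$ is an arbitrary terminal, and for $i\ge 2$, $t_i$ is a terminal maximizing $d(t_i,\{t_1,\dots,t_{i-1}\})$ (ties broken arbitrarily). Metric-Relaxed-Voronoi algorithm: input a metric $(X,d)$, terminals $K$, ordering $\pi=(t_1,\dots,t_k)$, magnitudes $R_1,\dots,R_k\ge1$. Initially no point is mapped. For $j=1,\dots,k$ in order: for every not-yet-mapped point $x$ with $d(t_j,x)\le R_j\cdot D(x)$, set $f(x)=t_j$. Return $f$. *)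

(* Defs.v *)
From HB Require Import structures.
From mathcomp Require Import all_boot all_order all_algebra.
From mathcomp Require Import all_classical all_reals all_analysis.

Set Implicit Arguments.
Unset Strict Implicit.
Unset Printing Implicit Defensive.
Import Order.TTheory GRing.Theory Num.Theory.

Local Open Scope classical_set_scope.
Local Open Scope ring_scope.

Section MetricDefs.
Context {R : realType} {X : metricType R}.

(* The distance d(x, A); the infimum is a minimum whenever A is finite and
   nonempty, see dist_set_attained.  With A the terminal set this is D(x). *)
Definition dist_set (x : X) (A : set X) : R := inf [set mdist x t | t in A].

(* The metric space (A, d|_A) has doubling dimension ddim: balls of A are the
   traces on A of the balls of X centred in A.  For finite A it does not matter
   whether open balls (as here) or closed ones are used. *)
Definition doubling_dim (A : set X) (ddim : R) : Prop :=
  forall (x : X) (r : R), A x -> 0 < r ->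
  exists s : seq X,
    [/\ (size s)%:R <= 2 `^ ddim,
        [set` s] `<=` A &
        A `&` ball x r `<=` \bigcup_(z in [set` s]) (A `&` ball z (r / 2))].

Section Terminals.
Variables (K : set X) (k : nat) (pi : k.-tuple X).

Definition enumerates : Prop := uniq pi /\ [set` pi] = K.

Definition gonzalez_order : Prop :=
  enumerates /\
  forall i : 'I_k, (0 < i)%N -> forall t, K t ->
    dist_set t [set` take i pi] <= dist_set (tnth pi i) [set` take i pi].

Section Voronoi.
Variable mag : 'I_k -> R.

Definition mrv_step (f : X -> option X) (j : 'I_k) : X -> option X :=
  fun x =>
    if f x is Some t then Some t
    else if mdist (tnth pi j) x <= mag j * dist_set x K then Some (tnth pi j)
    else None.

Definition mrv_partial : X -> option X :=
  foldl mrv_step (fun=> None) (enum 'I_k).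

(* The value returned for points left unmapped is irrelevant: when all the
   magnitudes are at least 1 there are none, see mrv_partial_total. *)
Definition metric_relaxed_voronoi (x : X) : X := odflt x (mrv_partial x).

End Voronoi.
End Terminals.

Lemma dist_set_attained (x : X) (A : set X) :
  finite_set A -> A !=set0 -> exists2 t, A t & dist_set x A = mdist x t.
Proof.
move=> finA [a0 Aa0].
have /finite_seqP[s sE] := finA.
have [t ts tmin] : exists2 t, t \in s & forall u, u \in s -> mdist x t <= mdist x u.
  have a0s : a0 \in s by move: Aa0; rewrite sE.
  clear sE finA Aa0 A; elim: s a0 a0s => //= b s IH a0 _.
  have [s0|] := eqVneq s [::].
    by exists b; rewrite ?mem_head// s0 => u; rewrite inE => /eqP ->.
  case: s IH => // c s IH _; have [t ts tm] := IH c (mem_head _ _).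
  have [bt|/ltW tb] := leP (mdist x b) (mdist x t).
    exists b; first exact: mem_head.
    by move=> u; rewrite inE => /orP[/eqP ->//|/tm]; exact: le_trans.
  exists t; first by rewrite inE ts orbT.
  by move=> u; rewrite inE => /orP[/eqP ->//|/tm].
have At : A t by rewrite sE.
exists t => //; apply/eqP; rewrite eq_le; apply/andP; split.
  apply: ge_inf; last by exists t.
  by exists 0 => _ [u _ <-]; exact: mdist_ge0.
apply: lb_le_inf; first by exists (mdist x t); exists t.
by move=> _ [u + <-]; rewrite sE => /tmin.
Qed.

Lemma mrv_partial_total (K : set X) (k : nat) (pi : k.-tuple X)
    (mag : 'I_k -> R) (x : X) :
  enumerates K pi -> K !=set0 -> (forall j, 1 <= mag j) ->
  exists2 t, K t & mrv_partial K pi mag x = Some t.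
Proof.
move=> [_ piK] K0 mag1.
have [t Kt Dt] : exists2 t, K t & dist_set x K = mdist x t.
  by apply: dist_set_attained => //; rewrite -piK; exact: finite_seq.
have /tnthP[j tj] : t \in pi by move: Kt; rewrite -piK.
have Kpi i : K (tnth pi i) by rewrite -piK /=; exact: mem_tnth.
suff H : forall s (f : X -> option X), (forall u, f x = Some u -> K u) ->
    (j \in s) || (f x != None) ->
    exists2 u, K u & foldl (mrv_step K pi mag) f s x = Some u.
  by apply: H => //; rewrite mem_enum.
elim=> [|i s IH] f fK /=.
  by case: (f x) fK => // u /(_ u erefl) Ku _; exists u.
rewrite inE => jf; apply: IH.
  move=> u; rewrite /mrv_step; case: (f x) fK => [v|_]; first by move=> /[apply].
  by case: ifP => // _ [<-]; exact: Kpi.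
rewrite /mrv_step; case: (f x) jf => [v _|]; first by rewrite orbT.
rewrite orbF => /orP[/eqP <-|->//].
rewrite -tj Dt metric_sym ifT ?orbT//.
by rewrite ler_peMl// mdist_ge0.
Qed.

Lemma metric_relaxed_voronoi_retract (K : set X) (k : nat) (pi : k.-tuple X)
    (mag : 'I_k -> R) :
  enumerates K pi -> (forall j, 1 <= mag j) ->
  (forall x, K !=set0 -> K (metric_relaxed_voronoi K pi mag x)) /\
  (forall t, K t -> metric_relaxed_voronoi K pi mag t = t).
Proof.
move=> enK mag1; split=> [x K0|t Kt]; rewrite /metric_relaxed_voronoi.
  by have [u Ku ->] := mrv_partial_total x enK K0 mag1.
suff : forall u, mrv_partial K pi mag t = Some u -> u = t.
  by case: (mrv_partial _ _ _ _) => //= u /(_ u erefl).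
have Dt : dist_set t K <= 0.
  rewrite -(mdistxx t); apply: ge_inf; last by exists t.
  by exists 0 => _ [u _ <-]; exact: mdist_ge0.
suff H : forall s (f : X -> option X), (forall u, f t = Some u -> u = t) ->
    forall u, foldl (mrv_step K pi mag) f s t = Some u -> u = t by exact: H.
elim=> [|i s IH] f ft //=.
apply: IH => u; rewrite /mrv_step; case: (f t) ft => [v|_]; first by move=> /[apply].
case: ifP => // di [<-]; apply: mdist_positivity; apply/eqP.
rewrite eq_le mdist_ge0 andbT (le_trans di)// mulr_ge0_le0//.
exact: le_trans ler01 (mag1 i).
Qed.

End MetricDefs.

Section ProbabilityDefs.
Context {d : measure_display} {T : measurableType d} {R : realType}.
Variable P : probability T R.

Definition mutually_independent (I : finType) (Z : I -> {RV P >-> R}) : Prop :=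
  forall (J : {set I}) (A : I -> set R),
    (forall i, i \in J -> measurable (A i)) ->
    P (\bigcap_(i in [set i | i \in J]) (Z i @^-1` A i)) =
    (\prod_(i in J) P (Z i @^-1` A i))%E.

(* Laws are compared on measurable sets only, since the value of a measure on
   a non-measurable set carries no information. *)
Definition exponential_rv (rate : R) (Z : {RV P >-> R}) : Prop :=
  forall A : set R, measurable A -> distribution P Z A = exponential_prob rate A.

End ProbabilityDefs.

(* Main.v *)
(* Write D for the distance to K.  If x is captured by t_l, then every earlier
   terminal is farther than 2 D(x) from x, so by the Gonzalez order all terminals
   that may capture x are D(x)-separated, and doubling leaves at most
   2^(ddim (m + O(1))) of them within 2^m D(x).  For c = 4 the exponential tails
   beat this count: the distance from x to its image exceeds 2^8 D(x) by O(D(x))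
   in expectation.  This settles the case D(x) <= 4 d(x,y).  Otherwise, on the
   logarithmic scale the capture thresholds of x and y at a given terminal differ
   by O(d(x,y) / D(x)), so by memorylessness the first terminal capturing one of
   x, y misses the other with probability O(ddim d(x,y) / D(x)); each later far
   capture is an independent event, so the cost of a separation is O(D(x)). *)
Require Import Defs.
From mathcomp Require Import all_boot all_order all_algebra.
From mathcomp Require Import all_classical all_reals all_analysis.
From mathcomp Require Import measurable_realfun.
From mathcomp Require Import zify ring lra.

Set Implicit Arguments.
Unset Strict Implicit.
Unset Printing Implicit Defensive.
Import Order.TTheory GRing.Theory Num.Theory.

Local Open Scope classical_set_scope.
Local Open Scope ring_scope.

(** * Distance to a set *)

Section DistanceToSet.
Context {R : realType} {X : metricType R}.
Implicit Types (x y t : X) (A : set X).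

Lemma dist_set_le x t A : A t -> dist_set x A <= mdist x t.
Proof.
move=> At; apply: ge_inf; last by exists t.
by exists 0 => _ [u _ <-]; exact: mdist_ge0.
Qed.

Lemma dist_set_ge0 x A : finite_set A -> A !=set0 -> 0 <= dist_set x A.
Proof. by move=> fA /(dist_set_attained x fA)[t _ ->]; exact: mdist_ge0. Qed.

Lemma dist_set_lipschitz x y A : finite_set A -> A !=set0 ->
  dist_set x A <= mdist x y + dist_set y A.
Proof.
move=> fA /(dist_set_attained y fA)[t At ->].
exact: le_trans (dist_set_le x At) (metric_triangle _ _ _).
Qed.

End DistanceToSet.

(** * Packing in doubling spaces *)

Lemma size_le_sum_count (T U : Type) (p : U -> pred T) (s : seq T) (c : seq U) :
  all (fun a => has (fun z => p z a) c) s ->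
  (size s <= \sum_(z <- c) count (p z) s)%N.
Proof.
elim: s => //= a s IH /andP[ca /IH]; rewrite big_split/= -add1n.
move=> le; apply: leq_add => //; move: ca; rewrite has_count -sum1_count big_mkcond.
by congr (_ <= _)%N; apply: eq_bigr => z _; case: (p z a).
Qed.

Section Packing.
Context {R : realType} {X : metricType R}.
Implicit Types (K : set X) (N : nat).

(** Integer form of the doubling property. Cover sizes are integers, so [2 ^ ddim] may be rounded
    down; the rounding is what excludes [ddim < 1] in [doubling_dim_ge1]. *)
Definition covered_by K N : Prop :=
  forall (x : X) (r : R), K x -> 0 < r ->
  exists s : seq X, [/\ (size s <= N)%N, [set` s] `<=` K &
    forall a, K a -> mdist x a < r -> exists2 z, z \in s & mdist z a < r / 2].

Lemma doubling_covered_by K (ddim : R) :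
  doubling_dim K ddim -> covered_by K (Num.truncn (2 `^ ddim)).
Proof.
move=> dd x r Kx r0; have [s [ss sK cov]] := dd x r Kx r0.
exists s; split => //; first by rewrite truncn_ge_nat// powR_ge0.
move=> a Ka xa; have [|z zs [_ za]] := cov a; last first.
  by exists z => //; move: za; rewrite ballEmdist.
by split => //; rewrite ballEmdist.
Qed.

(** Each halving of the radius costs a factor [N]. After [n] halvings the balls have radius [rho],
    and two points in one of them would be closer than [2 * rho]. *)
Lemma packing K N (n : nat) (x : X) (rho : R) (S : seq X) :
  covered_by K N -> K x -> 0 < rho -> uniq S -> [set` S] `<=` K ->
  {in S, forall a, mdist x a < 2 ^+ n * rho} ->
  {in S &, forall a b, a != b -> 2 * rho <= mdist a b} ->
  (size S <= N ^ n)%N.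
Proof.
move=> cov + rho0; elim: n x S => [|n IH] x S Kx uS SK xS sep.
  case: S uS SK xS sep => [//|a [//|b S]] /= /andP[ab _] _ xS sep.
  have aS : a \in [:: a, b & S] by rewrite mem_head.
  have bS : b \in [:: a, b & S] by rewrite !inE eqxx orbT.
  have neq : a != b by move: ab; rewrite inE negb_or => /andP[].
  have := sep _ _ aS bS neq; have := metric_triangle a x b.
  have := xS _ aS; have := xS _ bS; rewrite (metric_sym x a) expr0; lra.
have r0 : 0 < 2 ^+ n.+1 * rho by rewrite mulr_gt0// exprn_gt0.
have [s [sN sK sc]] := cov x _ Kx r0.
have hs : all (fun a => has (fun z => mdist z a < 2 ^+ n * rho) s) S.
  apply/allP => a aS; apply/hasP; have [|z zs za] := sc a _ (xS a aS).
    exact: SK.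
  by exists z => //; apply: lt_le_trans za _; rewrite exprS; lra.
apply: leq_trans (size_le_sum_count hs) _.
apply: (@leq_trans (\sum_(z <- s) N ^ n)%N); last first.
  by rewrite big_const_seq count_predT iter_addn_0 mulnC expnS leq_mul2r sN orbT.
rewrite big_seq [X in (_ <= X)%N]big_seq; apply: leq_sum => z zs.
rewrite -size_filter; apply: (IH z); first exact: sK.
- exact: filter_uniq.
- by move=> a /=; rewrite mem_filter => /andP[_]; exact: SK.
- by move=> a; rewrite mem_filter => /andP[].
- by move=> a b; rewrite !mem_filter => /andP[_ aS] /andP[_ bS]; exact: sep.
Qed.

(** If [ddim < 1], a single half-radius ball always suffices, so packing would leave room for one
    point only. The bound gives [2 <= 2 ^ ddim], which absorbs all absolute constants later. *)
Lemma doubling_dim_ge1 K (ddim : R) (a b : X) :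
  0 < ddim -> doubling_dim K ddim -> K a -> K b -> a != b -> 1 <= ddim.
Proof.
move=> d0 dd Ka Kb ab; rewrite leNgt; apply/negP => d1.
have := doubling_covered_by dd; have N1 : (Num.truncn (2 `^ ddim) <= 1)%N.
  rewrite -ltnS truncn_lt_nat ?powR_ge0//.
  rewrite /powR pnatr_eq0/= -[ltRHS](@lnK _ 2) ?posrE// ltr_expR.
  by rewrite gtr_pMl// ln_gt0// ltr1n.
move=> cov; have ab0 : 0 < mdist a b by rewrite mdist_gt0.
have [rho [rho0 abE]] : exists rho : R, 0 < rho /\ mdist a b = 2 * rho.
  by exists (mdist a b / 2); split; [rewrite divr_gt0|rewrite mulrC divfK].
(* The exponent is 2 because balls are open: [b] lies at distance exactly [2 * rho] from [a], hence
   inside radius [4 * rho] but not inside [2 * rho]. *)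
have : (size [:: a; b] <= Num.truncn (2 `^ ddim) ^ 2)%N.
  apply: (packing (x := a) cov Ka rho0).
  - by rewrite /= inE ab.
  - by move=> u; rewrite /= !inE => /orP[/eqP->|/eqP->].
  - by move=> u; rewrite !inE => /orP[/eqP->|/eqP->]; rewrite ?mdistxx ?abE expr2; lra.
  - move=> u v; rewrite !inE => /orP[/eqP->|/eqP->] /orP[/eqP->|/eqP->].
    all: try by rewrite ?eqxx ?(metric_sym b a) ?abE.
by move: N1; case: (Num.truncn _) => [|[|]].
Qed.

End Packing.

(** * The first terminal that captures a point *)

Section FirstCapture.
Context {R : realType} {X : metricType R}.
Variables (K : set X) (k : nat) (pi : k.-tuple X) (mag : 'I_k -> R) (x : X).

Lemma foldl_mrv_step_some (s : seq 'I_k) (f : X -> option X) t :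
  f x = Some t -> foldl (mrv_step K pi mag) f s x = Some t.
Proof. by elim: s f => //= j s IH f fx; apply: IH; rewrite /mrv_step fx. Qed.

(** Precedence is expressed by [index] so that the induction runs over an arbitrary scan [s]; on
    [enum 'I_k] it becomes the order of ordinals. *)
Lemma foldl_mrv_step_first (s : seq 'I_k) (f : X -> option X) t :
  f x = None -> foldl (mrv_step K pi mag) f s x = Some t ->
  exists l, [/\ t = tnth pi l, mdist (tnth pi l) x <= mag l * dist_set x K &
    forall i, (index i s < index l s)%N ->
      mag i * dist_set x K < mdist (tnth pi i) x].
Proof.
elim: s f => [|j s IH] f fx /=; first by rewrite fx.
have [cj|ncj] := leP (mdist (tnth pi j) x) (mag j * dist_set x K).
  rewrite (@foldl_mrv_step_some _ _ (tnth pi j)) => [[<-]|]; last first.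
    by rewrite /mrv_step fx cj.
  by exists j; split => // i; rewrite eqxx ltn0.
move=> /IH[|l [-> cl lmin]]; first by rewrite /mrv_step fx leNgt ncj.
exists l; split => // i; have [<- //|_] := eqVneq j i.
case: eqVneq => [jl|_]; first by move: ncj; rewrite jl ltNge cl.
exact: lmin.
Qed.

Lemma mrv_first_capture : enumerates K pi -> K !=set0 -> (forall j, 1 <= mag j) ->
  exists l, [/\ metric_relaxed_voronoi K pi mag x = tnth pi l,
    mdist (tnth pi l) x <= mag l * dist_set x K &
    forall i : 'I_k, (i < l)%N -> mag i * dist_set x K < mdist (tnth pi i) x].
Proof.
move=> enK K0 mag1; rewrite /metric_relaxed_voronoi.
have [t _ E] := mrv_partial_total x enK K0 mag1; rewrite E /=.
have [//|l [-> cl lmin]] := foldl_mrv_step_first _ E.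
by exists l; split => // i il; apply: lmin; rewrite !index_enum_ord.
Qed.

End FirstCapture.

(** * Separation and number of the terminals that may capture a point *)

Section Relevant.
Context {R : realType} {X : metricType R}.
Variables (K : set X) (k : nat) (pi : k.-tuple X).

(* Since all magnitudes are at least 2, these are the only terminals that may
   capture x. *)
Definition relevant (x : X) (l : 'I_k) : bool :=
  [forall i : 'I_k, (i < l)%N ==> (2 * dist_set x K < mdist (tnth pi i) x)].

Hypothesis gonz : gonzalez_order K pi.
Hypothesis K0 : K !=set0.

Lemma gonzalez_finite : finite_set K.
Proof. by case: gonz => -[_ <-] _; exact: finite_seq. Qed.

Lemma gonzalez_mem l : K (tnth pi l).
Proof. by case: gonz => -[_ <-] _ /=; exact: mem_tnth. Qed.

(** Let [t] be a terminal nearest to [x]. Every [u] earlier than [l] is farther than [2 D(x)] from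
    [x], hence farther than [D(x)] from [t]. The Gonzalez choice puts the [l]-th terminal at least
    as far from its predecessors as [t]. *)
Lemma relevant_separated x (l l' : 'I_k) : relevant x l -> (l' < l)%N ->
  dist_set x K < mdist (tnth pi l) (tnth pi l').
Proof.
move=> /forallP rel ll'; have [t Kt Dt] := dist_set_attained x gonzalez_finite K0.
have mem_take_tnth (i : 'I_k) : (i < l)%N -> tnth pi i \in take l pi.
  move=> il; rewrite (tnth_nth x); apply/(nthP x); exists i.
    by rewrite size_take size_tuple ltn_ord.
  by rewrite nth_take.
have l'T := mem_take_tnth _ ll'.
apply: lt_le_trans (dist_set_le (tnth pi l) (_ : [set` take l pi] _)); last exact: l'T.
have l0 : (0 < l)%N by exact: leq_ltn_trans ll'.
apply: lt_le_trans (gonz.2 l l0 t Kt).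
have [|u uT ->] := dist_set_attained t (finite_seq (take l pi)).
  by exists (tnth pi l').
move: (uT) => /= /(nthP x)[i]; rewrite size_take size_tuple ltn_ord => il uE.
have ik : (i < k)%N by exact: ltn_trans il _.
have {}uE : u = tnth pi (Ordinal ik) by rewrite -uE nth_take// (tnth_nth x).
move: (rel (Ordinal ik)); rewrite /= il /= -uE Dt => h.
have := metric_triangle u t x; rewrite (metric_sym u t) (metric_sym t x); lra.
Qed.

(** Packing around the terminal [t] nearest to [x], with [rho = D(x) / 2]. The distances to [t] are
    at most [2^m D(x) + D(x)], which is below [2^(m+2) rho] because [0 < m]. *)
Lemma card_relevant (N m : nat) x (L : {set 'I_k}) :
  covered_by K N -> (0 < m)%N -> 0 < dist_set x K ->
  {in L, forall l, relevant x l} ->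
  {in L, forall l, mdist (tnth pi l) x <= 2 ^+ m * dist_set x K} ->
  (#|L| <= N ^ m.+2)%N.
Proof.
move=> cov m0 D0 rel dL; have [t Kt Dt] := dist_set_attained x gonzalez_finite K0.
have injpi : injective (tnth pi) by apply/tuple_uniqP; case: gonz => -[].
rewrite cardE -(size_map (tnth pi)).
have h0 : 0 < dist_set x K / 2 by rewrite divr_gt0.
apply: (packing (x := t) cov Kt h0).
- by rewrite map_inj_uniq ?enum_uniq.
- by move=> _ /mapP[l _ ->]; exact: gonzalez_mem.
- move=> _ /mapP[l + ->]; rewrite mem_enum => /dL dl.
  have := metric_triangle t x (tnth pi l); rewrite (metric_sym t x) -Dt.
  rewrite (metric_sym x (tnth pi l)) => tl; apply: le_lt_trans tl _.
  have : 1 < 2 ^+ m :> R by rewrite exprn_egt1// ?ltr1n -?lt0n.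
  rewrite -(ltr_pM2r D0) mul1r !exprS; move: dl; lra.
- move=> _ _ /mapP[l + ->] /mapP[l' + ->]; rewrite !mem_enum => lL lL' /eqP neq.
  rewrite mulrCA divff ?mulr1//.
  have [ll'|ll'|/val_inj ll'] := ltngtP l l'; last by rewrite ll' in neq.
    by rewrite metric_sym ltW// relevant_separated// rel.
  by rewrite ltW// relevant_separated// rel.
Qed.

End Relevant.

(** * Far captures and their expected cost *)

Section FarTerminals.
Context {R : realType} {X : metricType R}.
Variables (K : set X) (k : nat) (pi : k.-tuple X).

(** The survival function [Pr[Z >= a]] of the exponential law, for [a] of either sign. *)
Definition expo_tail (rate a : R) : R := expR (- (rate * Num.max a 0)).

(** The cost of a capture that is not covered by the flat allowance [2^8 D(x)]. The guards make it
    vanish for terminals that cannot capture [x], so it can be summed over all [l]. *)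
Definition far_dist (x : X) (l : 'I_k) : R :=
  if [&& 0 < dist_set x K, relevant K pi x l &
         2 ^+ 8 * dist_set x K < mdist (tnth pi l) x]
  then mdist (tnth pi l) x else 0.

(** When [D(x) > 0], the least value of [Z_l] at which the [l]-th terminal reaches [x]; see
    [thresholdE]. *)
Definition threshold (x : X) (l : 'I_k) : R :=
  ln (mdist (tnth pi l) x / (2 * dist_set x K)).

Lemma far_dist_ge0 x l : 0 <= far_dist x l.
Proof. by rewrite /far_dist; case: ifP => // _; exact: mdist_ge0. Qed.

Lemma le_far_dist x l : 0 < dist_set x K -> relevant K pi x l ->
  mdist (tnth pi l) x <= 2 ^+ 8 * dist_set x K + far_dist x l.
Proof.
move=> D0 rel; rewrite /far_dist D0 rel/=; case: ltP => h; last by rewrite addr0.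
by rewrite lerDr mulr_ge0// ltW// exprn_gt0.
Qed.

Lemma half_le_ln2 : 1 <= 2 * ln 2 :> R.
Proof.
have : 2^-1 <= expR (- 2^-1) :> R by apply: le_trans (expR_ge1Dx _); lra.
rewrite -ler_ln ?posrE ?expR_gt0 ?invr_gt0// expRK lnV ?posrE//; lra.
Qed.

(** Beyond [2^(i+8) D(x)] the threshold is at least [(i+7) ln 2]. The slack of 1 costs at most
    [2 ln 2], leaving [(i+5) ln 2], which the rate multiplies by [4 ddim]. The slack lets the tail
    be taken at the threshold of a nearby point. *)
Lemma expo_tail_scale (ddim : R) (x : X) l (u : R) (i : nat) :
  0 < ddim -> 0 < dist_set x K ->
  2 ^+ (i + 8) * dist_set x K < mdist (tnth pi l) x -> threshold x l - 1 <= u ->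
  expo_tail (4 * ddim) u <= ((2 `^ ddim) ^+ (4 * (i + 5)))^-1.
Proof.
move=> d0 D0 far thu; rewrite /powR pnatr_eq0/= -expRM_natl -expRN ler_expR lerN2.
have le_u : (i + 5)%:R * ln 2 <= u.
  apply: le_trans thu; rewrite lerBrDr.
  have le_ln : (i + 7)%:R * ln 2 <= threshold x l.
    rewrite mulr_natl -lnXn// ler_ln ?posrE ?exprn_gt0//; last first.
      by rewrite divr_gt0 ?mulr_gt0// (lt_trans _ far)// mulr_gt0// exprn_gt0.
    rewrite ler_pdivlMr ?mulr_gt0//; apply: le_trans (ltW far).
    by rewrite mulrA -exprSr -addnS.
  apply: le_trans le_ln; rewrite !natrD !mulrDl; have := half_le_ln2; lra.
rewrite natrM (_ : _ * _ = 4 * ddim * ((i + 5)%:R * ln 2)); last by ring.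
by rewrite ler_pM2l ?mulr_gt0// le_max le_u.
Qed.

Hypothesis gonz : gonzalez_order K pi.
Hypothesis K0 : K !=set0.

(* Within distance 2^(i+9) D of x there are at most b^(i+11) relevant terminals,
   b = 2^ddim, whereas beyond 2^(i+8) D the tail is at most b^(-4(i+5)): the
   shell at scale i contributes at most 2^(-i) D. *)
Lemma sum_far_dist (ddim : R) (x : X) (u : 'I_k -> R) :
  1 <= ddim -> doubling_dim K ddim ->
  (0 < dist_set x K -> forall l, threshold x l - 1 <= u l) ->
  \sum_l expo_tail (4 * ddim) (u l) * far_dist x l <= 2 * dist_set x K.
Proof.
move=> d1 dd; have d0 : 0 < ddim by exact: lt_le_trans d1.
have [D0 /(_ isT) thu|D0 _] := ltP 0 (dist_set x K); last first.
  rewrite big1 => [|l _]; last by rewrite /far_dist ltNge D0/= mulr0.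
  by rewrite mulr_ge0// dist_set_ge0//; exact: gonzalez_finite gonz.
set D := dist_set x K in D0 *; set b : R := 2 `^ ddim.
have b2 : 2 <= b by rewrite -[X in X <= _]powRr1// ler_powR// ler1n.
have b0 : 0 < b by exact: lt_le_trans b2.
pose dl l := mdist (tnth pi l) x.
pose psi i := (b ^+ (4 * (i + 5)))^-1 * (2 ^+ (i + 9) * D).
have psi0 i : 0 <= psi i by rewrite mulr_ge0 ?mulr_ge0 ?invr_ge0 ?exprn_ge0 ?ltW.
pose A i := [set l : 'I_k | relevant K pi x l & dl l <= 2 ^+ (i + 9) * D]%SET.
(* A number of shells large enough to contain every terminal. *)
pose I := Num.bound (\sum_l dl l / D).
have dI l : dl l <= 2 ^+ (I + 8) * D.
  rewrite -ler_pdivrMr//; apply: (@le_trans _ _ (\sum_l dl l / D)).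
    rewrite (bigD1 l)//= lerDl sumr_ge0// => j _.
    by rewrite divr_ge0 ?mdist_ge0 ?ltW.
  apply/ltW/(lt_le_trans (upper_nthrootP (leqnn _))).
  by rewrite ler_weXn2l ?ler1n ?leq_addr.
have term l : expo_tail (4 * ddim) (u l) * far_dist x l
    <= \sum_(i < I) (l \in A i)%:R * psi i.
  rewrite /far_dist -/D D0/=.
  case: ifP => [/andP[rel far]|_]; last first.
    by rewrite mulr0 sumr_ge0// => i _; rewrite mulr_ge0.
  have exm : exists m, dl l <= 2 ^+ (m + 9) * D.
    by exists I; apply: le_trans (dI l) _; rewrite ler_pM2r// ler_weXn2l ?ler1n ?leq_add2l.
  case: (ex_minnP exm) => m dm mmin.
  have lo : 2 ^+ (m + 8) * D < dl l.
    (* In the innermost shell the lower bound is the cutoff of [far_dist]; in the others it is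
       minimality of [m]. *)
    case: m dm mmin => [//|m] _ mmin; rewrite ltNge; apply/negP => h.
    by move: h; rewrite addSnnS => /mmin; rewrite ltnn.
  have mI : (m < I)%N.
    rewrite ltnNge; apply/negP => Im; move: lo; rewrite ltNge => /negP; apply.
    by apply: le_trans (dI l) _; rewrite ler_pM2r// ler_weXn2l ?ler1n ?leq_add2r.
  rewrite (bigD1 (Ordinal mI))//=.
  apply: (@le_trans _ _ ((l \in A m)%:R * psi m)); last first.
    by rewrite lerDl sumr_ge0// => i _; rewrite mulr_ge0.
  rewrite inE rel dm mul1r; apply: ler_pM => //; rewrite ?expR_ge0 ?mdist_ge0//.
  exact: expo_tail_scale (thu l).
apply: le_trans (ler_sum _ (fun l _ => term l)) _.
rewrite exchange_big/=.
have shell (i : nat) : \sum_(l < k) (l \in A i)%:R * psi i <= D * 2^-1 ^+ i.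
  have -> : \sum_(l < k) (l \in A i)%:R * psi i = (#|A i|)%:R * psi i.
    rewrite -mulr_suml -natr_sum -sum1_card [in RHS]big_mkcond/=.
    by congr (_%:R * _); apply: eq_bigr => l _; case: (l \in A i).
  have cA : (#|A i|)%:R <= b ^+ (i + 11).
    have := doubling_covered_by dd => /(card_relevant gonz K0 (m := i + 9) (x := x) (L := A i)).
    have -> : ((i + 9).+2 = i + 11)%N by rewrite !addnS.
    move=> cA; apply: (@le_trans _ _ ((Num.truncn b ^ (i + 11))%:R)).
      rewrite ler_nat cA// ?addn_gt0 ?orbT// => l; first by rewrite inE => /andP[].
      by rewrite inE => /andP[].
    by rewrite natrX lerXn2r ?nnegrE ?ler0n ?(ltW b0)// truncn_le (ltW b0).
  apply: (@le_trans _ _ (b ^+ (i + 11) * psi i)); first by rewrite ler_wpM2r.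
  rewrite /psi exprVn ler_pdivlMr ?exprn_gt0//.
  rewrite [X in X <= _](_ : _ = D * (b ^+ (i + 11) * 2 ^+ (i + 9) * 2 ^+ i / b ^+ (4 * (i + 5)))).
    rewrite ger_pMr// ler_pdivrMr ?exprn_gt0// mul1r.
    (* As [2 <= b], all factors become powers of [b], and (i+11) + (i+9) + i = 3i + 20 is at most
       4(i+5). Here the rate 4 and the cutoff [2^8] are spent. *)
    apply: (@le_trans _ _ (b ^+ (i + 11) * b ^+ (i + 9) * b ^+ i)).
      have le2 j : 2 ^+ j <= b ^+ j by rewrite lerXn2r ?nnegrE ?(ltW b0).
      rewrite -!mulrA ler_pM2l ?exprn_gt0//.
      by apply: ler_pM; rewrite ?exprn_ge0.
    by rewrite -!exprD ler_weXn2l ?(le_trans _ b2) ?ler1n//; lia.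
  by ring.
apply: (@le_trans _ _ (\sum_(i < I) D * 2^-1 ^+ i)).
  by apply: ler_sum => i _; exact: shell.
rewrite -mulr_sumr mulrC ler_pM2r//.
have -> : \sum_(i < I) 2^-1 ^+ i = 2 - 2 * 2^-1 ^+ I :> R.
  elim: (I) => [|n IH]; first by rewrite big_ord0 expr0; ring.
  by rewrite big_ord_recr/= IH exprS; field.
by rewrite gerBl mulr_ge0// exprn_ge0// invr_ge0.
Qed.

End FarTerminals.

(** * Tails of the exponential law *)

Section ExponentialTail.
Context {R : realType}.
Implicit Types (rate a b : R).

Lemma expo_tail_ge0 rate a : 0 <= expo_tail rate a.
Proof. exact: expR_ge0. Qed.

Lemma expo_tail_le1 rate a : 0 < rate -> expo_tail rate a <= 1.
Proof.
move=> r0; rewrite -expR0 ler_expR oppr_le0; apply: mulr_ge0; first exact: ltW.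
by rewrite le_max lexx orbT.
Qed.

Lemma expo_tail_npos rate a : a <= 0 -> expo_tail rate a = 1.
Proof. by move=> a0; rewrite /expo_tail max_r// mulr0 oppr0 expR0. Qed.

(** Memorylessness factors the tail at [b] as the tail at [a] times an exponential, and
    [1 - e^(-s) <= s]. Truncating both arguments at 0 does not increase their gap. *)
Lemma expo_tail_sub rate a b : 0 < rate -> a <= b ->
  expo_tail rate a - expo_tail rate b <= rate * (b - a) * expo_tail rate a.
Proof.
move=> r0 ab; set p := Num.max a 0; set q := Num.max b 0.
have pq : q - p <= b - a by rewrite /p /q; case: (leP a 0); case: (leP b 0); lra.
have -> : expo_tail rate b = expo_tail rate a * expR (- (rate * (q - p))).
  by rewrite -expRD; congr expR; rewrite -/p -/q; ring.
rewrite -[X in X - _]mulr1 -mulrBr [X in _ <= X]mulrC ler_wpM2l ?expo_tail_ge0//.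
have := expR_ge1Dx (- (rate * (q - p))).
have : rate * (q - p) <= rate * (b - a) by rewrite ler_pM2l.
lra.
Qed.

Context {d : measure_display} {T : measurableType d} (P : probability T R).

Lemma probabilityU (A B : set T) : measurable A -> measurable B ->
  A `&` B = set0 -> P (A `|` B) = (P A + P B)%E.
Proof. exact: measureU. Qed.

(** The negative half-line and the point [a] are null, so for [a > 0] the complement of the
    half-line has the mass of [[0, a]]. *)
Lemma exponential_rv_tail rate (Z : {RV P >-> R}) a : 0 < rate ->
  exponential_rv rate Z -> P (Z @^-1` `[a, +oo[) = (expo_tail rate a)%:E.
Proof.
move=> r0 expZ.
have neg (A : set R) : measurable A -> A `<=` `]-oo, 0[ -> P (Z @^-1` A) = 0%E.
  move=> mA A0; rewrite -[LHS]/(distribution P Z A) expZ//.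
  apply: integral0_eq => x /A0; rewrite /= in_itv/= => x0.
  by rewrite lt0_exponential_pdf.
have [a0|a0] := leP a 0.
  rewrite expo_tail_npos//.
  have -> : Z @^-1` `[a, +oo[ = ~` (Z @^-1` `]-oo, a[).
    by rewrite preimage_setC setCitvl.
  rewrite probability_setC; last exact: measurable_funPTI.
  rewrite neg ?sube0// => x; rewrite /= !in_itv/= => xa; exact: lt_le_trans a0.
have -> : Z @^-1` `[a, +oo[ = ~` (Z @^-1` `]-oo, a[).
  by rewrite preimage_setC setCitvl.
rewrite probability_setC; last exact: measurable_funPTI.
have -> : Z @^-1` `]-oo, a[ = Z @^-1` `]-oo, 0[ `|` Z @^-1` `[0, a[.
  rewrite -preimage_setU; congr (_ @^-1` _); apply/seteqP; split => x /=; rewrite !in_itv/=.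
    by move=> xa; case: (ltP x 0) => x0; [left|right; rewrite xa].
  by move=> [x0|/andP[]//]; exact: lt_trans a0.
rewrite probabilityU; [|exact: measurable_funPTI..|]; last first.
  rewrite -preimage_setI (_ : _ `&` _ = set0) ?preimage_set0//.
  apply/seteqP; split => x //= []; rewrite !in_itv/= => x0 /andP[].
  by rewrite leNgt x0.
rewrite neg// add0e.
have point : P (Z @^-1` [set a]) = 0%E.
  by rewrite -[LHS]/(distribution P Z _) expZ//; exact: integral_set1.
have : P (Z @^-1` `[0, a]) = (1 - (expR (- rate * a))%:E)%E.
  by rewrite -[LHS]/(distribution P Z _) expZ// exponential_prob_itv0c.
have -> : Z @^-1` `[0, a] = Z @^-1` `[0, a[ `|` Z @^-1` [set a].
  by rewrite -preimage_setU setUitv1// bnd_simp ltW.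
rewrite probabilityU; [|exact: measurable_funPTI..|]; last first.
  rewrite -preimage_setI (_ : _ `&` _ = set0) ?preimage_set0//.
  by apply/seteqP; split => x //= [] /[swap] ->; rewrite in_itv/= ltxx andbF.
rewrite point adde0 => ->.
suff -> : expo_tail rate a = 1 - (1 - expR (- rate * a)) by [].
by rewrite /expo_tail max_l ?ltW// -mulNr; ring.
Qed.

Lemma exponential_rv_lt rate (Z : {RV P >-> R}) a : 0 < rate ->
  exponential_rv rate Z -> P (Z @^-1` `]-oo, a[) = (1 - expo_tail rate a)%:E.
Proof.
move=> r0 expZ.
have -> : Z @^-1` `]-oo, a[ = ~` (Z @^-1` `[a, +oo[).
  by rewrite preimage_setC setCitvr.
rewrite probability_setC; last exact: measurable_funPTI.
by rewrite (exponential_rv_tail a r0 expZ).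
Qed.

Lemma exponential_rv_itv rate (Z : {RV P >-> R}) a b : 0 < rate -> a <= b ->
  exponential_rv rate Z ->
  P (Z @^-1` `[a, b[) = (expo_tail rate a - expo_tail rate b)%:E.
Proof.
move=> r0 ab expZ; have := exponential_rv_lt b r0 expZ.
have -> : Z @^-1` `]-oo, b[ = Z @^-1` `]-oo, a[ `|` Z @^-1` `[a, b[.
  rewrite -preimage_setU; congr (_ @^-1` _); apply/seteqP; split => x /=; rewrite !in_itv/=.
    by move=> xb; case: (ltP x a) => xa; [left|right; rewrite xb].
  by move=> [xa|/andP[]//]; exact: lt_le_trans ab.
rewrite probabilityU; [|exact: measurable_funPTI..|]; last first.
  rewrite -preimage_setI (_ : _ `&` _ = set0) ?preimage_set0//.
  apply/seteqP; split => x //= []; rewrite !in_itv/= => xa /andP[].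
  by rewrite leNgt xa.
rewrite (exponential_rv_lt a r0 expZ).
have : P (Z @^-1` `[a, b[) \is a fin_num.
  by apply: fin_num_measure; exact: measurable_funPTI.
case: (P _) => //= p _; rewrite -EFinD => -[h]; congr (_%:E).
lra.
Qed.

(** Almost surely all magnitudes are then at least 2, so no point stays unmapped; the pointwise
    bounds below are proved on this event. *)
Lemma exponential_rv_ge0 rate (I : finType) (Z : I -> {RV P >-> R}) : 0 < rate ->
  (forall i, exponential_rv rate (Z i)) -> \forall w \ae P, forall i, 0 <= Z i w.
Proof.
move=> r0 expZ; apply: filter_forall => i; exists (Z i @^-1` `]-oo, 0[); split.
- exact: measurable_funPTI.
- by rewrite (exponential_rv_lt 0 r0 (expZ i)) expo_tail_npos// subrr.
- by move=> w /= /negP; rewrite -ltNge in_itv.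
Qed.

End ExponentialTail.

(** * Independence and bounds on expectations *)

Section ExpectationBounds.
Context {R : realType} {d : measure_display} {T : measurableType d}.
Variable P : probability T R.

Lemma independent_bigcap (I : finType) (Z : I -> {RV P >-> R}) (A : I -> set R)
    (h : I -> R) : mutually_independent Z -> (forall i, measurable (A i)) ->
  (forall i, P (Z i @^-1` A i) = (h i)%:E) ->
  P (\bigcap_i (Z i @^-1` A i)) = (\prod_i h i)%:E.
Proof.
move=> indZ mA PA; have := indZ [set: I]%SET A (fun i _ => mA i).
have -> : [set i | i \in [set: I]%SET] = [set: I].
  by apply/seteqP; split => i //= _; rewrite inE.
move=> ->; rewrite -prodEFin; apply: eq_big => [i|i _]; first by rewrite inE.
exact: PA.
Qed.

Lemma expectation_le_sum_indic (I : finType) (X : T -> R) (kappa : R)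
    (c p : I -> R) (E : I -> set T) :
  measurable_fun [set: T] X -> (forall w, 0 <= X w) ->
  0 <= kappa -> (forall i, 0 <= c i) -> (forall i, measurable (E i)) ->
  (forall i, (P (E i) <= (p i)%:E)%E) ->
  (\forall w \ae P, X w <= kappa + \sum_i c i * \1_(E i) w) ->
  ('E_P[X] <= (kappa + \sum_i c i * p i)%:E)%E.
Proof.
move=> mX X0 k0 c0 mE pE leX.
have mci i : measurable_fun [set: T] (fun w => c i * \1_(E i) w).
  by apply: measurable_funM => //; exact: measurable_indic.
have ci0 i w : 0 <= c i * \1_(E i) w by rewrite mulr_ge0// indicE.
have mS : measurable_fun [set: T] (fun w => \sum_i c i * \1_(E i) w).
  exact: measurable_sum.
have S0 w : 0 <= \sum_i c i * \1_(E i) w by rewrite sumr_ge0.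
apply: le_trans (expectation_le mX _ X0 _ leX) _.
- exact: measurable_funD.
- by move=> w; rewrite addr_ge0.
rewrite expectation.unlock.
under eq_integral do rewrite EFinD.
rewrite ge0_integralD//=; [|by move=> w _; rewrite lee_fin|exact/measurable_EFinP].
rewrite integral_cst//= (_ : P [set: T] = 1%E) ?mule1 ?EFinD ?leeD2l//; last exact: probability_setT.
under eq_integral do rewrite -sumEFin.
rewrite ge0_integral_sum//=; last first.
- by move=> i w _; rewrite lee_fin.
- by move=> i; exact/measurable_EFinP.
rewrite -sumEFin; apply: lee_sum => i _.
under eq_integral do rewrite EFinM.
rewrite ge0_integralZl_EFin//=; last first.
  by apply/measurable_EFinP; exact: measurable_indic.
have -> : (\int[P]_w (\1_(E i) w)%:E = P (E i))%E.
  by rewrite (integral_indic P measurableT (mE i)) setIT.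
by rewrite EFinM lee_wpmul2l ?lee_fin.
Qed.

End ExpectationBounds.

(** * Measurability of the stretch *)

Section Measurability.
Context {R : realType} {X : metricType R} {d : measure_display} {T : measurableType d}.

(** The target carries no sigma-algebra and is treated as discrete, so every preimage is required to
    be measurable. *)
Definition measurable_fibres (U : Type) (h : T -> U) : Prop :=
  forall B : set U, measurable (h @^-1` B).

Lemma measurable_fibres_cst U (u : U) : measurable_fibres (fun=> u).
Proof.
move=> B; have [Bu|nBu] := pselect (B u).
  by rewrite (_ : _ @^-1` _ = setT)//; apply/seteqP; split.
by rewrite (_ : _ @^-1` _ = set0)//; apply/seteqP; split.
Qed.

Lemma measurable_fibres_if U (b : T -> bool) (h h' : T -> U) :
  measurable [set w | b w] -> measurable_fibres h -> measurable_fibres h' ->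
  measurable_fibres (fun w => if b w then h w else h' w).
Proof.
move=> mb mh mh' B.
rewrite (_ : _ @^-1` _ = ([set w | b w] `&` h @^-1` B) `|`
                         (~` [set w | b w] `&` h' @^-1` B)).
  by apply: measurableU; apply: measurableI => //; exact: measurableC.
apply/seteqP; split => w /=; first by case: ifP => bw ?; [left|right].
by case=> -[]; [move=> -> |move=> /negP/negbTE ->].
Qed.

Lemma measurable_fibres_foldl (K : set X) (k : nat) (pi : k.-tuple X)
    (mag : T -> 'I_k -> R) (x : X) (s : seq 'I_k) (h : T -> X -> option X) :
  (forall j, measurable_fun [set: T] (fun w => mag w j)) ->
  measurable_fibres (fun w => h w x) ->
  measurable_fibres (fun w => foldl (mrv_step K pi (mag w)) (h w) s x).
Proof.
move=> mmag; elim: s h => //= j s IH h mh; apply: (IH (fun w => mrv_step K pi (mag w) (h w) j)).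
rewrite /mrv_step.
rewrite (_ : (fun w => _) = fun w => if h w x != None then h w x else
    if mdist (tnth pi j) x <= mag w j * dist_set x K then Some (tnth pi j) else None).
  apply: measurable_fibres_if => //.
    exact: (mh [set u | u != None]).
  apply: measurable_fibres_if; [|exact: measurable_fibres_cst..].
  have mm : measurable_fun [set: T] (fun w => mag w j * dist_set x K).
    exact: measurable_funM.
  have := mm measurableT [set` `[mdist (tnth pi j) x, +oo[] (measurable_itv _).
  by rewrite setTI; congr measurable; apply/seteqP; split => w /=; rewrite in_itv/= andbT.
by apply/funext => w; case: (h w x).
Qed.

Lemma measurable_mrv_mdist (K : set X) (k : nat) (pi : k.-tuple X)
    (mag : T -> 'I_k -> R) (x y : X) :
  finite_set [set: X] -> (forall j, measurable_fun [set: T] (fun w => mag w j)) ->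
  measurable_fun [set: T] (fun w => mdist (metric_relaxed_voronoi K pi (mag w) x)
                                          (metric_relaxed_voronoi K pi (mag w) y)).
Proof.
move=> finX mmag _ B _; rewrite setTI.
have mf z (C : set X) :
    measurable [set w | C (metric_relaxed_voronoi K pi (mag w) z)].
  have := @measurable_fibres_foldl K k pi mag z (enum 'I_k) (fun _ _ => None) mmag
    (measurable_fibres_cst _).
  by move=> /(_ [set u | C (odflt z u)]).
(* Fixing the value [u] of f(x), among finitely many, leaves an event about f(y) alone. *)
rewrite (_ : _ @^-1` _ = \bigcup_(u in [set: X])
    ([set w | [set u] (metric_relaxed_voronoi K pi (mag w) x)] `&`
     [set w | [set v | B (mdist u v)] (metric_relaxed_voronoi K pi (mag w) y)])).
  apply: fin_bigcup_measurable => // u _; apply: measurableI.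
    exact: (mf x [set u]).
  exact: (mf y [set v | B (mdist u v)]).
apply/seteqP; split => w /=; last by move=> [u _ [/= ->]].
by move=> Bw; exists (metric_relaxed_voronoi K pi (mag w) x).
Qed.

End Measurability.

(** * First success among independent trials *)

Section FirstSuccess.
Context {R : realType} {k : nat}.
Variable tau : 'I_k -> R.
Hypothesis tau01 : forall j, 0 <= tau j <= 1.

(** The probability that independent trials with success probabilities [tau] all fail before [j]. *)
Definition none_before (j : 'I_k) : R := \prod_(i < k | (i < j)%N) (1 - tau i).

Lemma none_before_ge0 j : 0 <= none_before j.
Proof. by apply: prodr_ge0 => i _; have := tau01 i; lra. Qed.

Lemma none_before_le1 j : none_before j <= 1.
Proof. by apply: prodr_ile1 => i _; have := tau01 i; lra. Qed.

(** The sum telescopes: each term is the drop of the product of failure probabilities when trial [j]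
    is added. *)
Lemma sum_first_success : \sum_j none_before j * tau j <= 1.
Proof.
(* Extending [tau] by 0 to all naturals lets the telescoping run by induction on the number of
   trials. *)
pose p n := oapp tau 0 (insub n).
have pE (i : 'I_k) : p i = tau i by rewrite /p valK.
have tele n : \sum_(j < n) \prod_(i < j) (1 - p i) * p j = 1 - \prod_(i < n) (1 - p i).
  elim: n => [|n IH]; first by rewrite !big_ord0 subrr.
  by rewrite big_ord_recr/= IH [in RHS]big_ord_recr/=; ring.
apply: (@le_trans _ _ (\sum_(j < k) \prod_(i < j) (1 - p i) * p j)).
  apply: ler_sum => j _; rewrite pE (big_ord_widen k (fun i => 1 - p i)) ?(ltnW (ltn_ord j))//.
  by rewrite le_eqVlt; apply/orP; left; apply/eqP; congr (_ * _); apply: eq_bigr => i _; rewrite pE.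
by rewrite tele gerBl; apply: prodr_ge0 => i _; rewrite pE; have := tau01 i; lra.
Qed.

(** The left side multiplies, coordinate by coordinate, the probabilities of the conditions called
    [cut] below; the factor for [l] survives only when [l] comes after [j]. *)
Lemma prod_cut (q : R) (j l : 'I_k) :
  \prod_(i < k) (if (i < j)%N then 1 - tau i else if i == j then q
           else if i == l then tau i else 1)
  = none_before j * (q * if (j < l)%N then tau l else 1).
Proof.
rewrite (bigID (fun i : 'I_k => (i < j)%N))/=; congr (_ * _).
  by apply: eq_bigr => i ->.
rewrite (bigD1 j) ?ltnn//= eqxx; congr (_ * _).
case: ifPn => jl.
  have lj : l != j by apply: contraTneq jl => ->; rewrite ltnn.
  rewrite (bigD1 l)/=; last by rewrite -leqNgt (ltnW jl).
  rewrite ltnNge (ltnW jl)/= (negbTE lj) eqxx big1 ?mulr1// => i /andP[/andP[/negbTE -> /negbTE ->] /negbTE ->].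
  by [].
rewrite big1// => i /andP[ij /negbTE inj]; rewrite (negbTE ij) inj.
case: eqVneq => // il; move: jl ij; rewrite -il -!leqNgt => ij ji.
by move: inj; rewrite -val_eqE/= eqn_leq ij ji.
Qed.

(** Bounding [q j] by [beta * tau j] turns the sum over [j] into a first-success sum, at most
    [beta]. Given [j], the later captures add the full sum of [tau l * g l]. A second copy of that
    sum pays for the diagonal terms [g j], where [none_before j] is bounded by 1. *)
Lemma sum_cut (g q : 'I_k -> R) (kappa beta : R) :
  0 <= kappa -> 0 <= beta -> (forall l, 0 <= g l) ->
  (forall j, 0 <= q j <= beta * tau j) ->
  \sum_(jl : 'I_k * 'I_k)
    (if (jl.1 < jl.2)%N then g jl.2 else if jl.2 == jl.1 then kappa + g jl.1 else 0) *
    (none_before jl.1 * (q jl.1 * if (jl.1 < jl.2)%N then tau jl.2 else 1))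
  <= beta * (kappa + 2 * \sum_l tau l * g l).
Proof.
move=> k0 b0 g0 qb; set S := \sum_l tau l * g l.
rewrite -(pair_bigA _ (fun j l : 'I_k => (if (j < l)%N then g l else if l == j then kappa + g j else 0) *
    (none_before j * (q j * if (j < l)%N then tau l else 1))))/=.
have S0 : 0 <= S by apply: sumr_ge0 => l _; rewrite mulr_ge0//; have := tau01 l; lra.
have row (j : 'I_k) : \sum_(l < k) (if (j < l)%N then g l else if l == j then kappa + g j else 0) *
    (none_before j * (q j * if (j < l)%N then tau l else 1))
    <= beta * (none_before j * tau j * (kappa + S) + tau j * g j).
  have W0 := none_before_ge0 j; have W1 := none_before_le1 j.
  have [t0 t1] := andP (tau01 j); have [q0 q1] := andP (qb j).
  apply: (@le_trans _ _ (\sum_l none_before j * q j * ((l == j)%:R * (kappa + g j) + tau l * g l))).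
    apply: ler_sum => l _; have [tl0 tl1] := andP (tau01 l).
    have Wq : 0 <= none_before j * q j by rewrite mulr_ge0.
    rewrite [X in X <= _](_ : _ = none_before j * q j *
      ((if (j < l)%N then g l else if l == j then kappa + g j else 0) *
       if (j < l)%N then tau l else 1)); last first.
      by rewrite mulrCA -mulrA; congr (_ * _); rewrite mulrCA.
    rewrite ler_wpM2l//; case: ifPn => [jl|_].
      by rewrite mulrC lerDr mulr_ge0// addr_ge0.
    by case: eqVneq => _; rewrite ?mul1r mulr1 ?mul0r ?add0r ?lerDl mulr_ge0.
  rewrite -mulr_sumr.
  have -> : \sum_(l < k) ((l == j)%:R * (kappa + g j) + tau l * g l) = kappa + g j + S.
    rewrite big_split/= (bigD1 j)//= eqxx mul1r big1 ?addr0// => l /negbTE ->.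
    by rewrite mul0r.
  apply: (@le_trans _ _ (beta * (none_before j * tau j * (kappa + g j + S)))).
    rewrite mulrA ler_wpM2r ?addr_ge0 ?S0// mulrCA ler_wpM2l//.
  by rewrite ler_wpM2l//; have := ler_wpM2r (mulr_ge0 t0 (g0 j)) W1; lra.
apply: le_trans (ler_sum _ (fun j _ => row j)) _.
rewrite -mulr_sumr ler_wpM2l// big_split/= -mulr_suml -/S.
have := ler_wpM2r (addr_ge0 k0 S0) sum_first_success; rewrite mul1r; lra.
Qed.

End FirstSuccess.

(** * Capture thresholds on the logarithmic scale *)

Lemma ln_sub_le {R : realType} (m a b : R) : 0 < m -> m <= a -> m <= b ->
  ln a - ln b <= `|a - b| / m.
Proof.
move=> m0 ma mb; have a0 := lt_le_trans m0 ma; have b0 := lt_le_trans m0 mb.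
rewrite -ln_div ?posrE//.
have -> : a / b = 1 + (a - b) / b by field; rewrite gt_eqF.
apply: le_trans (le_ln1Dx _) _.
  by rewrite mulrBl divff ?gt_eqF// ltrBrDr addNr divr_gt0.
apply: (@le_trans _ _ (`|a - b| / b)).
  by rewrite ler_pM2r ?invr_gt0// ler_norm.
by rewrite ler_wpM2l// lef_pV2 ?posrE.
Qed.

Section Thresholds.
Context {R : realType} {X : metricType R}.
Variables (K : set X) (k : nat) (pi : k.-tuple X).
Hypothesis gonz : gonzalez_order K pi.

Local Notation D x := (dist_set x K).

Lemma thresholdE (x : X) (l : 'I_k) (z : R) : 0 < D x ->
  (mdist (tnth pi l) x <= 2 * expR z * D x) = (threshold K pi x l <= z).
Proof.
move=> D0; have d0 : 0 < mdist (tnth pi l) x.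
  rewrite metric_sym; apply: lt_le_trans D0 (dist_set_le _ _).
  exact: gonzalez_mem gonz l.
rewrite mulrAC -ler_pdivrMl ?mulr_gt0// mulrC.
by rewrite -[LHS]ler_ln ?expRK// posrE ?expR_gt0// divr_gt0 ?mulr_gt0.
Qed.

(** The threshold is ln d(t, .) - ln 2 - ln D. Both d(t, .) and D are 1-Lipschitz and at least
    [3/4 D(x)] at [x] and at [y], so each logarithm moves by at most [4/3 d(x,y) / D(x)], and 8/3 is
    below 4. *)
Lemma threshold_sub_le (x y : X) (l : 'I_k) : K !=set0 ->
  4 * mdist x y < D x ->
  `|threshold K pi x l - threshold K pi y l| <= 4 * mdist x y / D x.
Proof.
move=> K0 xy; have xy0 := mdist_ge0 x y.
have D0 : 0 < D x by apply: le_lt_trans xy; rewrite mulr_ge0.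
have Dxy := dist_set_lipschitz x y (gonzalez_finite gonz) K0.
have Dyx := dist_set_lipschitz y x (gonzalez_finite gonz) K0.
rewrite (metric_sym y x) in Dyx.
have Dy0 : 0 < D y by lra.
have Kt := gonzalez_mem gonz l; set t := tnth pi l in Kt *.
have dx : D x <= mdist t x by rewrite metric_sym; exact: dist_set_le.
have dy : D y <= mdist t y by rewrite metric_sym; exact: dist_set_le.
have txy : `|mdist t x - mdist t y| <= mdist x y.
  have := metric_triangle t x y; have := metric_triangle t y x.
  by rewrite (metric_sym y x) ler_norml; lra.
have Dn : `|D x - D y| <= mdist x y by rewrite ler_norml; lra.
pose m := 3 / 4 * D x; have m0 : 0 < m by rewrite /m; lra.
have mx : m <= D x by rewrite /m; lra.
have my : m <= D y by rewrite /m; lra.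
have ln_le a b : m <= a -> m <= b -> `|a - b| <= mdist x y ->
    ln a - ln b <= 4 / 3 * (mdist x y / D x).
  move=> ma mb ab; apply: le_trans (ln_sub_le m0 ma mb) _.
  apply: (@le_trans _ _ (mdist x y / m)); first by rewrite ler_pM2r ?invr_gt0.
  by rewrite /m le_eqVlt; apply/orP; left; apply/eqP; field; rewrite gt_eqF.
have q0 : 0 <= mdist x y / D x by rewrite divr_ge0// ltW.
have thE z : 0 < D z -> D z <= mdist t z ->
    threshold K pi z l = ln (mdist t z) - ln 2 - ln (D z).
  move=> z0 tz; rewrite /threshold ln_div ?posrE ?mulr_gt0//.
    by rewrite lnM ?posrE// opprD addrA.
  exact: lt_le_trans tz.
rewrite !thE// -mulrA ler_norml.
have h1 := ln_le _ _ (le_trans mx dx) (le_trans my dy) txy.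
have h2 := ln_le _ _ mx my Dn.
have h3 : ln (mdist t y) - ln (mdist t x) <= 4 / 3 * (mdist x y / D x).
  by apply: ln_le; [exact: le_trans dy|exact: le_trans dx|rewrite distrC].
have h4 : ln (D y) - ln (D x) <= 4 / 3 * (mdist x y / D x).
  by apply: ln_le => //; rewrite distrC.
apply/andP; split; lra.
Qed.

Lemma first_capture (z : 'I_k -> R) (x : X) :
  K !=set0 -> (forall i, 0 <= z i) ->
  exists l, [/\ metric_relaxed_voronoi K pi (fun j => 2 * expR (z j)) x = tnth pi l,
    mdist (tnth pi l) x <= 2 * expR (z l) * D x,
    relevant K pi x l &
    0 < D x -> threshold K pi x l <= z l /\
      forall i : 'I_k, (i < l)%N -> z i < threshold K pi x i].
Proof.
move=> K0 z0; have e1 j : 1 <= expR (z j) by rewrite -expR0 ler_expR.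
have Dge0 := dist_set_ge0 x (gonzalez_finite gonz) K0.
have [||j|l [fl cl lmin]] := @mrv_first_capture _ _ K k pi (fun j => 2 * expR (z j)) x.
- by case: gonz.
- by [].
- have := e1 j; lra.
exists l; split => //.
  apply/forallP => i; apply/implyP => /lmin; apply: le_lt_trans.
  by rewrite ler_wpM2r//; have := e1 i; lra.
move=> D0; split; first by rewrite -thresholdE.
by move=> i /lmin; rewrite ltNge thresholdE// -ltNge.
Qed.

End Thresholds.

(** * Expected stretch for far and near pairs *)

Section StretchBounds.
Context {R : realType} {X : metricType R} {d : measure_display} {T : measurableType d}.
Variables (K : set X) (k : nat) (pi : k.-tuple X) (ddim : R) (P : probability T R).
Variable Z : 'I_k -> {RV P >-> R}.
Hypothesis finX : finite_set [set: X].
Hypothesis K0 : K !=set0.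
Hypothesis ddim1 : 1 <= ddim.
Hypothesis ddK : doubling_dim K ddim.
Hypothesis gonz : gonzalez_order K pi.
Hypothesis expZ : forall j, exponential_rv (4 * ddim) (Z j).

Local Notation D x := (dist_set x K).
Local Notation thr := (threshold K pi).
Local Notation far := (far_dist K pi).
Local Notation tail := (expo_tail (4 * ddim)).
Local Notation f w := (metric_relaxed_voronoi K pi (fun j => 2 * expR (Z j w))).

Let rate0 : 0 < 4 * ddim.
Proof. by rewrite mulr_gt0// (lt_le_trans ltr01). Qed.

Lemma measurable_stretch x y : measurable_fun [set: T] (fun w => mdist (f w x) (f w y)).
Proof.
apply: (@measurable_mrv_mdist _ _ _ _ K k pi (fun w j => 2 * expR (Z j w))) => // j.
by apply: measurable_funM => //; apply: measurableT_comp.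
Qed.

(** Triangle inequality through [x] and [y]: each image pays the flat [2^8 D] plus its far captures,
    whose expected cost is at most [2 D]. In ['I_k + 'I_k] the left copy indexes the captures of
    [x], the right one those of [y]. *)
Lemma expected_stretch_far x y :
  ('E_P[fun w => mdist (f w x) (f w y)] <=
   (mdist x y + (2 ^+ 8 + 2) * (D x + D y))%:E)%E.
Proof.
have finK := gonzalez_finite gonz.
have Dx0 := dist_set_ge0 x finK K0; have Dy0 := dist_set_ge0 y finK K0.
pose pt (s : 'I_k + 'I_k) := if s is inl _ then x else y.
pose ix (s : 'I_k + 'I_k) := match s with inl l => l | inr l => l end.
pose E s := Z (ix s) @^-1` `[thr (pt s) (ix s), +oo[.
pose kappa := mdist x y + 2 ^+ 8 * (D x + D y).
have ptwise w (z : X) : (forall j, 0 <= Z j w) ->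
    mdist (f w z) z <= 2 ^+ 8 * D z +
      \sum_l far z l * \1_(Z l @^-1` `[thr z l, +oo[) w.
  move=> Zw; have [l [-> cl rel hl]] := first_capture gonz z K0 Zw.
  have Dz0 := dist_set_ge0 z finK K0.
  have s0 (l' : 'I_k) : 0 <= far z l' * \1_(Z l' @^-1` `[thr z l', +oo[) w :> R.
    by rewrite mulr_ge0 ?far_dist_ge0// indicE.
  (* When D(z) = 0 the capture condition itself forces distance 0. *)
  have [D0|D0] := ltP 0 (D z); last first.
    apply: (@le_trans _ _ 0); last by rewrite addr_ge0 ?sumr_ge0// mulr_ge0// exprn_ge0.
    by apply: le_trans cl _; rewrite mulr_ge0_le0// mulr_ge0// expR_ge0.
  apply: le_trans (le_far_dist D0 rel) _; rewrite lerD2l (bigD1 l)//=.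
  have [thl _] := hl D0.
  by rewrite indicE mem_set ?mulr1 ?lerDl ?sumr_ge0//= in_itv/= thl.
have bound z : \sum_l far z l * tail (thr z l) <= 2 * D z.
  under eq_bigr do rewrite mulrC.
  by apply: (sum_far_dist gonz K0 ddim1 ddK) => _ l; rewrite gerBl.
apply: le_trans (@expectation_le_sum_indic R d T P ('I_k + 'I_k)%type
  (fun w => mdist (f w x) (f w y)) kappa (fun s => far (pt s) (ix s))
  (fun s => tail (thr (pt s) (ix s))) E (measurable_stretch x y) _ _ _ _ _ _) _.
- by move=> w; exact: mdist_ge0.
- by rewrite /kappa addr_ge0 ?mdist_ge0// mulr_ge0 ?exprn_ge0 ?addr_ge0.
- by move=> s; exact: far_dist_ge0.
- by move=> s; exact: measurable_funPTI.
- by move=> s; rewrite (exponential_rv_tail _ rate0 (expZ _)).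
- near=> w; have Zw : forall j, 0 <= Z j w by near: w; exact: exponential_rv_ge0 expZ.
  rewrite big_sumType/=; have := ptwise w x Zw; have := ptwise w y Zw.
  have := metric_triangle (f w x) x (f w y); have := metric_triangle x y (f w y).
  by rewrite (metric_sym y (f w y)) /kappa/E/=; lra.
- by rewrite lee_fin big_sumType/=; have := bound x; have := bound y; rewrite /kappa; lra.
Unshelve. all: by end_near.
Qed.

Hypothesis indZ : mutually_independent Z.

Section Near.
Variables x y : X.
Hypothesis xy : 4 * mdist x y < D x.

Let u l := Num.min (thr x l) (thr y l).
Let v l := Num.max (thr x l) (thr y l).
Let g l := far x l + far y l.
Let kappa := mdist x y + 2 ^+ 8 * (D x + D y).
(** The pair (j, j) pays for the separation at [j], a pair (j, l) with [l] after [j] only for the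
    far capture by [l]. *)
Let coef (jl : 'I_k * 'I_k) : R :=
  if (jl.1 < jl.2)%N then g jl.2 else if jl.2 == jl.1 then kappa + g jl.1 else 0.
(* For l > j: neither x nor y is captured before step j, exactly one of them is
   at step j, and l could capture one of them; for l <= j the last condition is void. *)
Let cut (jl : 'I_k * 'I_k) (i : 'I_k) : set R :=
  if (i < jl.1)%N then `]-oo, u i[%classic
  else if i == jl.1 then `[u i, v i[%classic
  else if i == jl.2 then `[u i, +oo[%classic else setT.

Let xy0 : 0 <= mdist x y. Proof. exact: mdist_ge0. Qed.

Let Dx0 : 0 < D x. Proof. by apply: le_lt_trans xy; rewrite mulr_ge0. Qed.

Let Dy0 : 0 < D y.
Proof.
by have := dist_set_lipschitz x y (gonzalez_finite gonz) K0; have := Dx0; have := xy; lra.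
Qed.

Let g_ge0 l : 0 <= g l. Proof. by rewrite addr_ge0 ?far_dist_ge0. Qed.

Let kappa_ge0 : 0 <= kappa.
Proof.
have Dx := ltW Dx0; have Dy := ltW Dy0.
by rewrite addr_ge0// mulr_ge0 ?exprn_ge0// addr_ge0.
Qed.

Let coef_ge0 jl : 0 <= coef jl.
Proof.
rewrite /coef; case: ifP => _; first exact: g_ge0.
by case: ifP => _ //; exact: addr_ge0 kappa_ge0 (g_ge0 _).
Qed.

Let measurable_cut jl i : measurable (cut jl i).
Proof. by rewrite /cut; do !case: ifP => _ //. Qed.

(** If the images differ, let [j] be the earlier capturing terminal and [l] the later one. The
    events of (j, j) and (j, l) both occur, and together they pay [kappa + g j + g l]. *)
Lemma stretch_le_sum_cut w : (forall j, 0 <= Z j w) ->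
  mdist (f w x) (f w y) <=
    \sum_jl coef jl * \1_(\bigcap_i (Z i @^-1` cut jl i)) w.
Proof.
move=> Zw.
have term0 jl : 0 <= coef jl * \1_(\bigcap_i (Z i @^-1` cut jl i)) w.
  by rewrite mulr_ge0// indicE.
have [lx [fx _ relx /(_ Dx0)[tx bx]]] := first_capture gonz x K0 Zw.
have [ly [fy _ rely /(_ Dy0)[ty by_]]] := first_capture gonz y K0 Zw.
have two (j l : 'I_k) : (j < l)%N -> u j <= Z j w < v j -> u l <= Z l w ->
    (forall i : 'I_k, (i < j)%N -> Z i w < u i) ->
    kappa + g j + g l <= \sum_jl coef jl * \1_(\bigcap_i (Z i @^-1` cut jl i)) w.
  move=> jl cj cl before.
  have mem1 l' : l' = j \/ l' = l -> (\bigcap_i (Z i @^-1` cut (j, l') i)) w.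
    move=> l'E i _; rewrite /cut/=; case: ifPn => [ij|_]; first by rewrite /= in_itv/= before.
    case: eqP => [->|_]; first by rewrite /= in_itv/=.
    case: eqP => // il'; rewrite /= in_itv/= andbT.
    by case: l'E il' => -> ->; [case/andP: cj|].
  have lj : (l == j) = false by apply/negbTE; rewrite -val_eqE gtn_eqF.
  rewrite (bigD1 (j, j))//= (bigD1 (j, l))/=; last by rewrite xpair_eqE lj andbF.
  rewrite !indicE !mem_set; [|by apply: mem1; right|by apply: mem1; left].
  rewrite !mulr1 /coef/= ltnn eqxx jl/= lerD2l lerDl sumr_ge0// => i _.
  exact: term0.
have le_g l : far x l <= g l /\ far y l <= g l.
  by rewrite /g lerDl lerDr !far_dist_ge0.
have key : mdist (f w x) (f w y) <= kappa + far x lx + far y ly.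
  rewrite fx fy; have := le_far_dist Dx0 relx; have := le_far_dist Dy0 rely.
  have := metric_triangle (tnth pi lx) x (tnth pi ly).
  have := metric_triangle x y (tnth pi ly).
  by rewrite (metric_sym y (tnth pi ly)) /kappa; lra.
have [eq_l|neq] := eqVneq lx ly; first by rewrite fx fy eq_l mdistxx sumr_ge0.
apply: le_trans key _.
have [xy_l|yx_l|/val_inj/eqP] := ltngtP lx ly; last by rewrite (negbTE neq).
- apply: le_trans (two lx ly xy_l _ _ _).
  + by have := le_g lx; have := le_g ly; lra.
  + by rewrite /u /v ge_min tx lt_max by_// orbT.
  + by rewrite /u ge_min ty orbT.
  + by move=> i il; rewrite /u lt_min bx// by_// (ltn_trans il).
- apply: le_trans (two ly lx yx_l _ _ _).
  + by have := le_g lx; have := le_g ly; lra.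
  + by rewrite /u /v ge_min ty orbT lt_max bx.
  + by rewrite /u ge_min tx.
  + by move=> i il; rewrite /u lt_min by_// bx// (ltn_trans il).
Qed.

(** Separation has rate [beta = 16 ddim d(x,y) / D(x)] and costs at most [2^10 D(x)]; the factor
    [D(x)] cancels and 16 times [2^10] is [2^14]. *)
Lemma expected_stretch_near :
  ('E_P[fun w => mdist (f w x) (f w y)] <= (2 ^+ 14 * ddim * mdist x y)%:E)%E.
Proof.
pose tau l := tail (u l); pose q l := tail (u l) - tail (v l).
pose beta := 4 * ddim * (4 * mdist x y / D x).
have tau01 l : 0 <= tau l <= 1 by rewrite expo_tail_ge0 expo_tail_le1.
have uv l : u l <= v l by rewrite /u /v ge_min le_max lexx.
have vu l : v l - u l <= 4 * mdist x y / D x.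
  have := threshold_sub_le gonz l K0 xy; rewrite ler_norml /u /v => /andP[lo hi].
  by case: (leP (thr x l) (thr y l)) => _; lra.
have beta0 : 0 <= beta.
  by rewrite /beta !mulr_ge0 ?divr_ge0 ?invr_ge0 ?(ltW Dx0)//; exact: le_trans ddim1.
have qb l : 0 <= q l <= beta * tau l.
  apply/andP; split.
    rewrite /q subr_ge0 /expo_tail ler_expR lerN2 ler_pM2l//.
    by rewrite ge_max le_max uv/= le_max lexx orbT.
  apply: le_trans (expo_tail_sub rate0 (uv l)) _.
  by rewrite /beta ler_wpM2r ?expo_tail_ge0// ler_pM2l.
have PE jl : P (\bigcap_i (Z i @^-1` cut jl i)) =
    (none_before tau jl.1 * (q jl.1 * if (jl.1 < jl.2)%N then tau jl.2 else 1))%:E.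
  rewrite -prod_cut; apply: independent_bigcap => // i; rewrite /cut.
  case: ifP => _; first by rewrite (exponential_rv_lt _ rate0 (expZ i)).
  case: eqP => [<-|_]; first by rewrite (exponential_rv_itv rate0 (uv i) (expZ i)).
  case: ifP => _; first by rewrite (exponential_rv_tail _ rate0 (expZ i)).
  by rewrite preimage_setT; exact: probability_setT.
apply: le_trans (@expectation_le_sum_indic R d T P ('I_k * 'I_k)%type
  (fun w => mdist (f w x) (f w y)) 0 coef
  (fun jl => none_before tau jl.1 * (q jl.1 * if (jl.1 < jl.2)%N then tau jl.2 else 1))
  (fun jl => \bigcap_i (Z i @^-1` cut jl i)) (measurable_stretch x y) _ _ _ _ _ _) _.
- by move=> w; exact: mdist_ge0.
- by [].
- exact: coef_ge0.
- by move=> jl; apply: fin_bigcap_measurable => // i _; exact: measurable_funPTI.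
- by move=> jl; rewrite PE.
- near=> w; rewrite add0r; apply: stretch_le_sum_cut.
  by near: w; exact: exponential_rv_ge0 expZ.
- rewrite lee_fin add0r; apply: le_trans (sum_cut tau01 kappa_ge0 beta0 g_ge0 qb) _.
  (* The thresholds of [x] and [y] differ by at most 1, which is the slack allowed in
     [sum_far_dist]. *)
  have far_sum z : z = x \/ z = y -> \sum_l tau l * far z l <= 2 * D z.
    move=> zE; apply: (sum_far_dist gonz K0 ddim1 ddK) => _ l.
    have v1 : v l - u l <= 1.
      by apply: le_trans (vu l) _; rewrite ler_pdivrMr// mul1r ltW.
    have zv : thr z l <= v l by case: zE => ->; rewrite /v le_max lexx ?orbT.
    lra.
  (* Here [D(y) <= 5/4 D(x)]. Counted twice, this sum contributes the 12 that the bound on [kappa]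
     leaves free. *)
  have S6 : \sum_l tau l * g l <= 6 * D x.
    rewrite /g; under eq_bigr do rewrite mulrDr.
    rewrite big_split/=; apply: le_trans (lerD (far_sum x _) (far_sum y _)) _; [by left|by right|].
    have := xy; have := xy0; have := dist_set_lipschitz y x (gonzalez_finite gonz) K0.
    by rewrite (metric_sym y x); lra.
  have kap : kappa <= (2 ^+ 10 - 12) * D x.
    have := xy; have := xy0; have := dist_set_lipschitz y x (gonzalez_finite gonz) K0.
    by rewrite (metric_sym y x) /kappa; lra.
  apply: (@le_trans _ _ (beta * (2 ^+ 10 * D x))).
    by rewrite ler_wpM2l//; lra.
  rewrite /beta le_eqVlt; apply/orP; left; apply/eqP; field.
  by rewrite gt_eqF.
Unshelve. all: by end_near.
Qed.

End Near.

(** If [D(x) <= 4 d(x,y)] then [D(y) <= 5 d(x,y)], so the far bound is at most (1 + 258 * 9) d(x,y),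
    below [2^14 d(x,y)]; [1 <= ddim] supplies the missing factor. *)
Lemma expected_stretch x y :
  ('E_P[fun w => mdist (f w x) (f w y)] <= (2 ^+ 14 * ddim * mdist x y)%:E)%E.
Proof.
have [xy|yx] := ltP (4 * mdist x y) (D x); first exact: expected_stretch_near.
apply: le_trans (expected_stretch_far x y) _; rewrite lee_fin.
have := dist_set_lipschitz y x (gonzalez_finite gonz) K0; rewrite (metric_sym y x).
have := ler_wpM2r (mdist_ge0 x y) ddim1; rewrite mul1r.
by have := mdist_ge0 x y; lra.
Qed.

End StretchBounds.


Theorem theorem2 (R : realType) :
  exists c C : R, [/\ 0 < c, 0 < C &
    forall (X : metricType R) (K : set X) (k : nat) (pi : k.-tuple X) (ddim : R)
      (d : measure_display) (T : measurableType d) (P : probability T R)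
      (Z : 'I_k -> {RV P >-> R}),
    finite_set [set: X] ->
    K !=set0 ->
    0 < ddim ->
    doubling_dim K ddim ->
    gonzalez_order K pi ->
    mutually_independent Z ->
    (forall j, exponential_rv (c * ddim) (Z j)) ->
    let f (w : T) : X -> X :=
      metric_relaxed_voronoi K pi (fun j => 2 * expR (Z j w)) in
    forall x y : X,
      ('E_P[fun w => mdist (f w x) (f w y)] <= (C * ddim * mdist x y)%:E)%E].
Proof.
exists 4, (2 ^+ 14); split; [by []|exact: exprn_gt0|].
move=> X K k pi ddim d T P Z finX K0 ddim0 ddK gonz indZ expZ f x y.
(* Two distinct terminals force [1 <= ddim]. With a single terminal [ddim] may be smaller, but the
   retraction is almost surely constant; the zero bound is obtained from an empty family of
   events. *)
have [[a [b [Ka Kb ab]]]|K1] := pselect (exists a b, [/\ K a, K b & a != b]).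
  by apply: expected_stretch => //; exact: doubling_dim_ge1 ddim0 ddK Ka Kb ab.
have : ('E_P[fun w => mdist (f w x) (f w y)] <= (0 + \sum_(i < 0) 0 * 0)%:E)%E.
  apply: (@expectation_le_sum_indic R d T P 'I_0 _ 0 (fun=> 0) (fun=> 0) (fun=> set0)) => //.
  - exact: measurable_stretch.
  - by move=> w; exact: mdist_ge0.
  - by case.
  near=> w; have Zw : forall j, 0 <= Z j w.
    by near: w; apply: exponential_rv_ge0 expZ; rewrite mulr_gt0.
  have [lx [fx _ _ _]] := first_capture gonz x K0 Zw.
  have [ly [fy _ _ _]] := first_capture gonz y K0 Zw.
  rewrite big_ord0 addr0 /f fx fy (_ : tnth pi lx = tnth pi ly) ?mdistxx//.
  apply/eqP/negPn/negP => neq; apply: K1; exists (tnth pi lx), (tnth pi ly).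
  by split => //; exact: gonzalez_mem gonz _.
move=> /le_trans; apply; rewrite big_ord0 addr0 lee_fin.
by apply: mulr_ge0 (mdist_ge0 _ _); apply: mulr_ge0 (ltW ddim0); exact: exprn_ge0.
Unshelve. all: by end_near.
Qed.
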